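(* Let $P$ and $Q$ be probability measures on a measurable space $\mathcal{X}$, let $Q = Q_a + Q_s$ be the Lebesgue decomposition of $Q$ with respect to $P$ ($Q_a \ll P$, $Q_s \perp P$), and let $U : [0,\infty] \to [-\infty,\infty]$ be measurable. Suppose that $\lambda\in[0,\infty)$ and $\varepsilon^*$, a valid e-value for $H=\{P\}$, satisfy $$\varepsilon^*(x) \in \operatorname*{arg\,max}_{z \in [0,\infty)} \left\{\frac{dQ_a}{dP}(x)\, U(z) - \lambda z\right\}, \quad P\text{-a.s.}, \qquad (\star)$$ with $\lambda(1-\mathrm{E}^P[\varepsilon^*])=0$ and $U(\varepsilon^* )$ finite $Q_a$-almost surely. - Positive multiplier. If $U$ is strictly increasing and $Q_a(\mathcal{X})>0$, then $\lambda>0$ and so $\mathrm{E}^P[\varepsilon^*]=1$. - Supergradient form. If $U$ is concave, then $(\star)$ is equivalent to $$\lambda \Big/ \frac{dQ_a}{dP} \in \partial U(\varepsilon^* ), \quad Q_a\text{-a.s.}$$ - Positivity. If $U(0)\in\mathbb{R}$ and $\lim_{z\downarrow 0}(U(z)-U(0))/z=\infty$, then $\varepsilon^*>0$, $Q_a$-almost surely. - Explicit form. Suppose that $U(0)=\lim_{z\downarrow 0}U(z)$ and that $U$ is differentiable on $(0,\infty)$ with strictly decreasing derivative satisfying $\lim_{z\downarrow 0}U'(z)=\infty$ and $\lim_{z\to\infty}U'(z)=0$. If $Q_a(\mathcal{X})>0$, then $\lambda>0$ and $$\varepsilon^* = (U')^{-1}\left(\lambda \Big/ \frac{dQ_a}{dP}\right),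 \quad Q_a\text{-a.s.}$$
   Context: Notation: $\mathrm{E}^\mu[f]=\int f\,d\mu$ for any nonnegative measure $\mu$; $dQ_a/dP$ is a $[0,\infty)$-valued version of the Radon--Nikodym derivative (it is positive $Q_a$-a.s.); convention $0\times U(z)=0$. Concavity and strict monotonicity of $U$ are understood on $[0,\infty)$ (valid e-values are finite $P$-a.s., hence $Q_a$-a.s., so $U(\infty)$ is immaterial). $\partial U$ denotes the superdifferential: for $x\in[0,\infty)$ with $U(x)$ finite, $\partial U(x)=\{g\in\mathbb{R}: U(z)-U(x)\le g(z-x)\ \text{for all } z\in[0,\infty)\}$. An e-value is a measurable map $\varepsilon:\mathcal{X}\to[0,\infty]$; it is valid for the simple hypothesis $H=\{P\}$ if $\mathrm{E}^P[\varepsilon]\le 1$.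
   Formalization: In the supergradient form, (⋆) P-a.s. is equivalent to the inclusion Q_a-a.s. together with λε*=0 P-a.s. on {dQ_a/dP=0}; without that clause the converse fails. The equivalence with both sides Q_a-a.s. is also stated. *)

(* Defs.v *)
From HB Require Import structures.
From mathcomp Require Import all_boot all_order all_algebra.
From mathcomp Require Import all_classical all_reals all_analysis.
From mathcomp Require Import measurable_realfun.

Set Implicit Arguments.
Unset Strict Implicit.
Unset Printing Implicit Defensive.

Import Order.TTheory GRing.Theory Num.Theory.
Import numFieldNormedType.Exports.

Local Open Scope classical_set_scope.
Local Open Scope ring_scope.
Local Open Scope ereal_scope.
Local Open Scope charge_scope.

Section measures.
Context {d : measure_display} {T : measurableType d} {R : realType}.

Definition mutually_singular (mu nu : set T -> \bar R) : Prop :=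
  exists N : set T, [/\ measurable N, mu N = 0 & nu (~` N) = 0].

Definition lebesgue_decomposition (P Q : probability T R)
    (Qa Qs : {finite_measure set T -> \bar R}) : Prop :=
  [/\ forall A, measurable A -> Q A = Qa A + Qs A,
      Qa `<< P & mutually_singular Qs P].

                                                                      
                                                                       
                           
Definition RN_version (nu mu : {finite_measure set T -> \bar R})
    (Z : T -> R) : Prop :=
  [/\ measurable_fun setT Z, forall x, (0 <= Z x)%R &
      {ae mu, forall x,
        (Z x)%:E = ('d (charge_of_finite_measure nu) '/d mu) x}].

Definition e_value (eps : T -> \bar R) : Prop :=
  measurable_fun setT eps /\ forall x, 0 <= eps x.

Definition valid_for (P : probability T R) (eps : T -> \bar R) : Prop :=
  \int[P]_x eps x <= 1.

End measures.

Section utilities.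
Context {R : realType}.
Implicit Types (U : \bar R -> \bar R) (x : \bar R).

                                                                         
Definition half_line : set (\bar R) := [set z | 0 <= z < +oo].

Definition argmax {S : Type} (D : set S) (f : S -> \bar R) : set S :=
  [set z | D z /\ forall y, D y -> f y <= f z].

                                                         
Definition lagrangian U (lambda a : R) (z : \bar R) : \bar R :=
  a%:E * U z - lambda%:E * z.

Definition strictly_increasing U : Prop :=
  forall y z, half_line y -> half_line z -> y < z -> U y < U z.

                                                                              
                                                                 
Definition concave U : Prop :=
  forall (y z : \bar R) (t : R), half_line y -> half_line z ->
    (0 <= t <= 1)%R ->
    t%:E * U y + (1 - t)%:E * U z <= U (t%:E * y + (1 - t)%:E * z).

                                                     
Definition superdifferential U x : set R :=
  [set g | [/\ half_line x, U x \is a fin_num &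
            forall z, half_line z -> U z - U x <= g%:E * (z - x)]].

Definition real_part U (z : R) : R := fine (U z%:E).

Definition differentiable_on_pos U : Prop :=
  forall z : R, (0 < z)%R ->
    U z%:E \is a fin_num /\ derivable (real_part U) z 1.

Definition real_deriv U : R -> R := (real_part U)^`()%classic.

                                                                  
Definition inverse_deriv U : R -> R :=
  'pinv_(fun=> 0%R) [set z : R | (0 < z)%R] (real_deriv U).

End utilities.

(* Main.v *)
Require Import Defs.
From mathcomp Require Import all_boot all_order all_algebra.
From mathcomp Require Import all_classical all_reals all_analysis.
From mathcomp Require Import measurable_realfun.
From mathcomp Require Import lra.

(** Wherever the density Z is positive and U (eps x) is finite, maximising
z |-> Z x * U z - lambda * z over the half line is, after dividing by Z x, the
statement that lambda / Z x is a supergradient of U at eps x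
([argmax_lagrangian_superdifferential]). As
Qa << P and Qa is P with density Z, both conditions hold Qa-almost
everywhere, so each claim reduces to a pointwise fact about a supergradient g
of U at a point e.

- If U increases strictly, comparing e with e + 1 gives g > 0. A positive
  multiplier together with complementary slackness exhausts the budget.
- Where Z = 0 the objective is - lambda * z, maximal at e exactly when
  lambda * e = 0; this is what separates the P-a.e. optimality condition from
  the Qa-a.e. one. The passage back to P uses that a Qa-null set is P-null up
  to {Z = 0} ([RN_version_ae]), and that eps is P-a.e. finite because it is
  integrable.
- A supergradient at 0 bounds all the difference quotients (U z - U 0) / z
  from above, so there is none when these blow up at 0.
- Under the Inada conditions the mean value theorem bounds these quotients
  below by U' z, so e > 0 by the previous point, and then z = e maximises the
  differentiable function U z - g * z in the interior, whence U' e = g. The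
  derivative is a bijection of the positive reals: it is injective by strict
  monotonicity, positive since it decreases to 0, and onto by Darboux's
  intermediate value property. Thus e is the preimage of g = lambda / Z x, and
  lambda > 0 since g is a value of U'. *)

Import Order.TTheory GRing.Theory Num.Theory.
Import numFieldNormedType.Exports.

Local Open Scope classical_set_scope.
Local Open Scope ring_scope.

(** * Functions on the positive reals with strictly decreasing derivative *)

Section decreasing_derivative.
Context {R : realType} {f : R -> R}.
Hypothesis df : forall z : R, (0 < z) -> derivable f z 1.
Hypothesis f'_dec :
  forall y z : R, (0 < y) -> (y < z) -> (f^`()%classic z < f^`()%classic y).

Let is_df (z : R) : (0 < z) -> is_derive z (1 : R) f (f^`()%classic z).
Proof. by move=> z0; rewrite derive1E; exact/derivableP/df. Qed.

Let MVT_pos (x y : R) : (0 < x) -> (x < y) ->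
  exists c : R, [/\ (x < c), (c < y) &
                    (f y - f x) = (f^`()%classic c * (y - x))].
Proof.
move=> x0 xy.
have [||c] := @MVT R f f^`()%classic x y xy.
- by move=> z; rewrite in_itv/= => /andP[xz _]; exact/is_df/(lt_trans x0).
- apply: derivable_within_continuous => z; rewrite in_itv/= => /andP[xz _].
  exact/df/(lt_le_trans x0).
- by rewrite in_itv/= => /andP[xc cy] E; exists c.
Qed.

(** Fermat's rule for the tilted function t |-> f t - g * t, phrased as a bound
on the increments of f so that it applies to supergradients directly. *)
Lemma derive1_tilted_max {g a b c : R} : (0 <= a) -> (a < c) -> (c < b) ->
  (forall t : R, (a < t) -> (t < b) -> (f t - f c <= g * (t - c))) ->
  f^`()%classic c = g.
Proof.
move=> a0 ac cb cmax.
pose h := (f - g *: (id : R -> R)).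
have dh (t : R) : (0 < t) ->
    is_derive t (1 : R) h (f^`()%classic t - g *: (1 : R)).
  by move=> t0; apply: is_deriveB; exact: is_df.
have : is_derive c (1 : R) h 0.
  apply: (@derive1_at_max R h a b c); rewrite ?in_itv/= ?ac//.
  - by rewrite ltW// (lt_trans ac).
  - move=> t; rewrite in_itv/= => /andP[ta _].
    by have [] := dh t (le_lt_trans a0 ta).
  - move=> t; rewrite in_itv/= => /andP[ta tb].
    have := cmax t ta tb; rewrite /h !fctE /GRing.scale /=; lra.
have /@derive_val := dh c (le_lt_trans a0 ac).
move=> E /@derive_val; rewrite E /GRing.scale /= mulr1 => /eqP.
by rewrite subr_eq0 => /eqP.
Qed.

(** A maximum c of h t = f t - y * t over [a, b] is a critical point. To avoid
treating the endpoints apart, c is shown to maximise h over the larger open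
interval ]0, b + 1[: as the derivative of f decreases, h increases before a and
decreases after b. *)
Lemma derive1_darboux {a b y : R} : (0 < a) -> (a < b) ->
  (f^`()%classic b < y) -> (y < f^`()%classic a) ->
  exists2 c : R, (0 < c) & f^`()%classic c = y.
Proof.
move=> a0 ab fby yfa.
pose h := (f - y *: (id : R -> R)).
have hE t : h t = (f t - y * t) by rewrite /h !fctE.
have ch : {within `[a, b], continuous h}.
  apply: derivable_within_continuous => z; rewrite in_itv/= => /andP[az _].
  by apply: derivableB; [exact/df/(lt_le_trans a0)|exact: derivableZ].
have [c] := EVT_max (ltW ab) ch; rewrite in_itv/= => /andP[ac cb] cmax.
have ha : (h a <= h c) by apply: cmax; rewrite in_itv/= lexx ltW.
have hb : (h b <= h c) by apply: cmax; rewrite in_itv/= lexx ltW.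
have c0 : (0 < c) by exact: lt_le_trans ac.
exists c => //.
apply: (@derive1_tilted_max y 0 (b + 1)) => //; first lra.
move=> t t0 tb.
suff : (h t <= h c) by rewrite !hE; lra.
have [ta|at_] := ltP t a.
  apply: le_trans ha; have [x [tx xa E]] := MVT_pos t a t0 ta.
  have yx : (y < f^`()%classic x).
    by apply: (lt_trans yfa); apply: f'_dec => //; exact: lt_trans tx.
  rewrite !hE; nra.
have [tb'|bt] := leP t b; first by apply: cmax; rewrite in_itv/= at_.
apply: le_trans hb; have [x [bx xt E]] := MVT_pos b t (lt_trans a0 ab) bt.
have yx : (f^`()%classic x < y).
  by apply: (lt_trans _ fby); apply: f'_dec => //; exact: lt_trans ab.
rewrite !hE; nra.
Qed.

(** A nonpositive value at z would keep the derivative below its negative value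
at z + 1 from there on, away from the limit 0. *)
Lemma derive1_gt0 : f^`()%classic z @[z --> +oo] --> (0 : R) ->
  forall z : R, (0 < z) -> (0 < f^`()%classic z).
Proof.
move=> f'0 z z0; rewrite ltNge; apply/negP => f'z.
have f'z1 : (f^`()%classic (z + 1) < 0).
  by apply: lt_le_trans f'z; apply: f'_dec => //; rewrite ltrDl.
have [w [zw]] : exists w : R,
    z + 1 < w /\ f^`()%classic (z + 1) < f^`()%classic w.
  apply: (@filter_ex _ (+oo : set_system R)); apply: filterI.
    exact: nbhs_pinfty_gt (num_real _).
  exact: cvgr_gt f'0 _ f'z1.
by apply/negP; rewrite -leNgt; apply/ltW; apply: f'_dec => //; exact: addr_gt0.
Qed.

Lemma derive1_bij :
  f^`()%classic z @[z --> (0 : R)^'+] --> +oo ->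
  f^`()%classic z @[z --> +oo] --> (0 : R) ->
  set_bij [set z : R | (0 < z)] [set y : R | (0 < y)] f^`()%classic.
Proof.
move=> f'oo f'0; split.
- by move=> z /= z0; exact: derive1_gt0.
- move=> x y /=; rewrite !inE /= => x0 y0 xy.
  have [xLy|yLx|//] := ltgtP x y.
  - by have := f'_dec x y x0 xLy; rewrite xy ltxx.
  - by have := f'_dec y x y0 yLx; rewrite xy ltxx.
- move=> y /= y0.
  have [a [a0 ya]] : exists a : R, (0 < a) /\ (y < f^`()%classic a).
    apply: (@filter_ex _ (0 : R)^'+); apply: filterI; first exact: nbhs_right_gt.
    exact: cvgry_gt f'oo _.
  have [b [ab by_]] : exists b : R, (a < b) /\ (f^`()%classic b < y).
    apply: (@filter_ex _ (+oo : set_system R)); apply: filterI.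
      exact: nbhs_pinfty_gt (num_real _).
    exact: cvgr_lt f'0 _ y0.
  by have [c c0 cy] := derive1_darboux a0 ab by_ ya; exists c.
Qed.

(** The chord from w to z has slope at least the derivative of f at z, its right
endpoint; let w tend to 0. The limit v takes the place of f 0, since
the derivative says nothing about f at 0. *)
Lemma derive1_le_slope0 {v : R} : f z @[z --> (0 : R)^'+] --> v ->
  forall z : R, (0 < z) -> (f^`()%classic z * z <= f z - v).
Proof.
move=> fv z z0.
have : (v <= f z - f^`()%classic z * (z - 0)).
  apply: (@ler_cvg_to _ _ _ _ f (fun w => f z - f^`()%classic z * (z - w))
    v _ fv).
    apply: cvgB; first exact: cvg_cst.
    apply: cvgMr; apply: cvgB; first exact: cvg_cst.
    exact: cvg_at_right_filter.
  near=> w.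
  have w0 : (0 < w) by near: w; exact: nbhs_right_gt.
  have wz : (w < z) by near: w; exact: nbhs_right_lt.
  have [c [wc cz E]] := MVT_pos w z w0 wz.
  have := f'_dec c z (lt_trans w0 wc) cz; nra.
by rewrite subr0; lra.
Unshelve. all: by end_near. Qed.

End decreasing_derivative.

Local Open Scope ereal_scope.

(** * Almost everywhere statements and densities *)

Section density.
Context {d : measure_display} {T : measurableType d} {R : realType}.
Implicit Types (P : probability T R) (nu : {finite_measure set T -> \bar R}).

Lemma ae_null_dominates {P nu} {p : T -> Prop} : nu `<< P ->
  {ae P, forall x, p x} -> {ae nu, forall x, p x}.
Proof.
move=> /null_content_dominatesP nuP [N [mN PN0 pN]].
by exists N; split => //; exact: nuP.
Qed.

(** Extracts a fact that does not depend on the point, such as the sign of the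
multiplier, from an almost everywhere argument. *)
Lemma ae_cst {nu} {p : Prop} : 0 < nu setT -> {ae nu, forall x : T, p} -> p.
Proof.
move=> nu0 [N [mN N0 pN]]; apply: contrapT => np.
have NT : N = setT by apply/seteqP; split => // x _; exact: pN.
by move: nu0; rewrite -NT N0 ltxx.
Qed.

Lemma RN_version_integral {P nu} {Z : T -> R} {A : set T} :
  nu `<< P -> RN_version nu P Z -> measurable A ->
  nu A = \int[P]_(x in A) (Z x)%:E.
Proof.
move=> nuP [mZ Z0 ZE] mA.
have -> : nu A = charge_of_finite_measure nu A by [].
rewrite (@Radon_Nikodym_integral _ _ _ (charge_of_finite_measure nu) P A nuP mA).
apply: ae_eq_integral => //.
- have /integrableP[+ _] : P.-integrable setT
    (Radon_Nikodym (charge_of_finite_measure nu) P) by exact: Radon_Nikodym_integrable.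
  exact: measurable_funS.
- by apply/measurable_EFinP; exact: measurable_funS mZ.
- by apply: filterS ZE => x -> _.
Qed.

Lemma RN_version_gt0_ae {P nu} {Z : T -> R} :
  nu `<< P -> RN_version nu P Z -> {ae nu, forall x, (0 < Z x)%R}.
Proof.
move=> nuP hZ; have [mZ Z0 _] := hZ.
have mA : measurable [set x | Z x = 0%R].
  by rewrite -[X in measurable X]setTI; exact: (mZ measurableT [set 0%R]).
exists [set x | Z x = 0%R]; split => //.
- rewrite (RN_version_integral nuP hZ mA).
  by apply: integral0_eq => x ->.
- by move=> x /= /negP; rewrite lt_neqAle Z0 andbT negbK => /eqP.
Qed.

(** A partial converse of absolute continuity: the integral of Z over a nu-null
set N vanishes, so Z = 0 at P-almost every point of N. *)
Lemma RN_version_ae {P nu} {Z : T -> R} {p : T -> Prop} :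
  nu `<< P -> RN_version nu P Z ->
  {ae nu, forall x, p x} -> {ae P, forall x, (0 < Z x)%R -> p x}.
Proof.
move=> nuP hZ [N [mN N0 pN]]; have [mZ Z0 _] := hZ.
have mZN : measurable_fun N (EFin \o Z).
  by apply/measurable_EFinP; exact: measurable_funS mZ.
have /(ae_eq_integral_abs P mN mZN) : \int[P]_(x in N) `|(EFin \o Z) x| = 0.
  rewrite -N0 (RN_version_integral nuP hZ mN).
  by apply: eq_integral => x _; rewrite /= ger0_norm.
apply: filterS => x ZN Zx; apply: contrapT => npx.
have /= [Zx0] := ZN (pN _ npx).
by move: Zx; rewrite Zx0 ltxx.
Qed.

End density.

(** * Supergradients of a utility *)

Section supergradient.
Context {R : realType}.
Implicit Types (U : \bar R -> \bar R) (e : \bar R) (a l g : R).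

Lemma half_lineP (z : \bar R) : half_line z <-> exists2 r : R, (0 <= r)%R & z = r%:E.
Proof.
split => [/=|[r r0 ->]]; last by rewrite /half_line /= lee_fin r0 ltry.
by case: z => [r||] /andP[]//; exists r.
Qed.

(** Both sides compare U z with U e after division by a. Infinite values of
U z are harmless since U e is finite: at +oo both inequalities fail, at -oo both
hold. *)
Lemma argmax_lagrangian_superdifferential {U l a e} :
  (0 < a)%R -> U e \is a fin_num ->
  argmax half_line (lagrangian U l a) e <-> superdifferential U e (l / a)%R.
Proof.
move=> a0 /fineK Ue.
have key (r s : R) : U r%:E \is a fin_num ->
    (lagrangian U l a s%:E <= lagrangian U l a r%:E) =
    (U s%:E - U r%:E <= (l / a)%:E * (s%:E - r%:E)).
  rewrite /lagrangian; case: (U r%:E) => // u _.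
  case: (U s%:E) => [w||] /=.
  - rewrite -!EFinM -!EFinB -?EFinM !lee_fin mulrAC ler_pdivlMr//.
    by apply/idP/idP; lra.
  - by rewrite gt0_muley ?lte_fin// addye.
  - by rewrite gt0_muleNy ?lte_fin// !addNye !leNye.
have Ufin : U e \is a fin_num by rewrite -Ue.
split => [[he emax]|[he _ emax]]; split => // z hz.
  move: he hz (emax z hz) => /half_lineP[r _ er] /half_lineP[s _ ->].
  by rewrite er key -?er.
move: he hz (emax z hz) => /half_lineP[r _ er] /half_lineP[s _ ->].
by rewrite er -key -?er.
Qed.

Lemma superdifferential_strictly_increasing_gt0 {U e g} :
  strictly_increasing U -> superdifferential U e g -> (0 < g)%R.
Proof.
move=> Uinc [he Ue eg].
have [r r0 er] := (half_lineP _).1 he.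
have he1 : half_line (r + 1)%:E by apply/half_lineP; exists (r + 1)%R => //; lra.
have := Uinc e (r + 1)%:E he he1; rewrite {1}er lte_fin ltrDl ltr01 => /(_ isT).
rewrite -sube_gt0.
move=> /lt_le_trans /(_ (eg _ he1)).
by rewrite er -EFinB -EFinM lte_fin addrAC subrr add0r mulr1.
Qed.

Lemma superdifferential_neq0 {U g} :
  (U z%:E - U 0) * (z^-1)%:E @[z --> (0 : R)%R^'+] --> +oo ->
  ~ superdifferential U 0 g.
Proof.
move=> /cvgeyPge /(_ (g + 1)%R) slope [_ U0 sg].
have : \forall z \near (0 : R)%R^'+, False.
  near=> z.
  have z0 : (0 < z)%R by near: z; exact: nbhs_right_gt.
  have : (g + 1)%:E <= (U z%:E - U 0) * (z^-1)%:E by near: z.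
  move=> gz; have := sg z%:E; rewrite sube0 => Uz.
  have {}Uz := Uz ((half_lineP _).2 (ex_intro2 _ _ z (ltW z0) erefl)).
  have : (g + 1)%:E <= g%:E.
    by apply: (le_trans gz); rewrite lee_pdivrMr.
  by rewrite lee_fin; lra.
by move=> /filter_ex[].
Unshelve. all: by end_near. Qed.

End supergradient.

(** * Marginal utility *)

Section marginal_utility.
Context {R : realType}.
Implicit Types (U : \bar R -> \bar R) (e : \bar R) (g : R).

(** An infinite marginal utility at 0 forces infinite difference quotients at 0,
so the explicit form inherits positivity from [superdifferential_neq0]. *)
Lemma real_deriv_slope0 {U} : U 0 \is a fin_num ->
  U z%:E @[z --> (0 : R)%R^'+] --> U 0 ->
  differentiable_on_pos U ->
  (forall y z : R, (0 < y)%R -> (y < z)%R ->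
    (real_deriv U z < real_deriv U y)%R) ->
  real_deriv U z @[z --> (0 : R)%R^'+] --> +oo%R ->
  (U z%:E - U 0) * (z^-1)%:E @[z --> (0 : R)%R^'+] --> +oo.
Proof.
move=> /fineK <- U0 dU U'dec U'oo.
have df (z : R) : (0 < z)%R -> derivable (real_part U) z 1 by move=> /dU[].
have u0 : real_part U z @[z --> (0 : R)%R^'+] --> fine (U 0) by exact: fine_cvg.
apply/cvgeyPge => A; near=> z.
have z0 : (0 < z)%R by near: z; exact: nbhs_right_gt.
have AU' : (A <= real_deriv U z)%R by near: z; exact: cvgry_ge U'oo _.
have [/fineK <- _] := dU z z0.
rewrite lee_pdivlMr// -EFinB -EFinM lee_fin.
apply: le_trans (derive1_le_slope0 df U'dec u0 z z0).
by rewrite ler_wpM2r// ltW.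
Unshelve. all: by end_near. Qed.

(** The supergradient inequality says that r maximises U z - g * z, here at an
interior point. *)
Lemma superdifferential_real_deriv {U} {r g : R} : (0 < r)%R ->
  differentiable_on_pos U -> superdifferential U r%:E g -> real_deriv U r = g.
Proof.
move=> r0 dU [_ _ rg].
have df (z : R) : (0 < z)%R -> derivable (real_part U) z 1 by move=> /dU[].
apply: (derive1_tilted_max df (g := g) (a := 0) (b := r + 1)%R) => //.
  by rewrite ltrDl.
move=> t t0 _; have := rg t%:E ((half_lineP _).2 (ex_intro2 _ _ t (ltW t0) erefl)).
have [/fineK <- _] := dU t t0; have [/fineK <- _] := dU r r0.
by rewrite -!EFinB -EFinM lee_fin.
Qed.

End marginal_utility.

(** * Optimal e-values *)

Theorem corollary2 (R : realType) (d : measure_display) (T : measurableType d)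
    (P Q : probability T R) (Qa Qs : {finite_measure set T -> \bar R})
    (Z : T -> R) (U : \bar R -> \bar R) (lambda : R) (eps : T -> \bar R)
    (hdec : lebesgue_decomposition P Q Qa Qs)
    (hZ : RN_version Qa P Z)
    (hU : measurable_fun [set z : \bar R | 0 <= z] U)
    (hlambda : (0 <= lambda)%R)
    (heps : e_value eps)
    (hvalid : valid_for P eps)
    (hslack : lambda%:E * (1 - \int[P]_x eps x) = 0)
    (hfin : {ae Qa, forall x, U (eps x) \is a fin_num}) :
  let star (x : T) : Prop :=
    argmax half_line (lagrangian U lambda (Z x)) (eps x) in
  [/\ (* positive multiplier *)
      {ae P, forall x, star x} ->
        strictly_increasing U -> 0 < Qa setT ->
        (0 < lambda)%R /\ \int[P]_x eps x = 1,
      (* supergradient form *)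
      concave U ->
        ({ae Qa, forall x, star x} <->
         {ae Qa, forall x, superdifferential U (eps x) (lambda / Z x)%R}) /\
        ({ae P, forall x, star x} <->
         {ae Qa, forall x, superdifferential U (eps x) (lambda / Z x)%R} /\
         {ae P, forall x, Z x = 0%R -> lambda%:E * eps x = 0}),
      (* positivity *)
      {ae P, forall x, star x} ->
        U 0 \is a fin_num ->
        (U z%:E - U 0) * (z^-1)%:E @[z --> (0 : R)%R^'+] --> +oo ->
        {ae Qa, forall x, 0 < eps x} &
      (* explicit form *)
      {ae P, forall x, star x} ->
        U z%:E @[z --> (0 : R)%R^'+] --> U 0 ->
        differentiable_on_pos U ->
        (forall y z : R, (0 < y)%R -> (y < z)%R -> (real_deriv U z < real_deriv U y)%R) ->
        real_deriv U z @[z --> (0 : R)%R^'+] --> +oo%R ->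
        real_deriv U z @[z --> +oo%R] --> (0 : R)%R ->
        set_bij [set z : R | (0 < z)%R] [set y : R | (0 < y)%R] (real_deriv U) /\
        (0 < Qa setT ->
         (0 < lambda)%R /\
         {ae Qa, forall x, eps x = (inverse_deriv U (lambda / Z x)%R)%:E})].
Proof.
move=> star; have [meps eps0] := heps; have [_ QaP _] := hdec.
have [_ Z0 _] := hZ.
have posfin : {ae Qa, forall x, (0 < Z x)%R /\ U (eps x) \is a fin_num}.
  by apply: filterS2 (RN_version_gt0_ae QaP hZ) hfin => x; split.
have starE : {ae Qa, forall x, star x} <->
    {ae Qa, forall x, superdifferential U (eps x) (lambda / Z x)%R}.
  split; apply: filterS2 posfin => x [Zx Ux].
    exact: (argmax_lagrangian_superdifferential Zx Ux).1.
  exact: (argmax_lagrangian_superdifferential Zx Ux).2.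
have star_sup : {ae P, forall x, star x} -> {ae Qa, forall x,
    (0 < Z x)%R /\ superdifferential U (eps x) (lambda / Z x)%R}.
  move=> /(ae_null_dominates QaP)/starE.
  by apply: filterS2 posfin => x [].
split.
- move=> hstar Uinc Qa0.
  have l0 : (0 < lambda)%R.
    apply: (ae_cst Qa0); apply: filterS (star_sup hstar) => x [Zx].
    move=> /(superdifferential_strictly_increasing_gt0 Uinc).
    by rewrite pmulr_lgt0// invr_gt0.
  split => //; move/eqP: hslack; rewrite mule_eq0 eqe gt_eqF// orFb => /eqP.
  have /fineK <- : \int[P]_x eps x \is a fin_num.
    rewrite ge0_fin_numE; first exact: le_lt_trans hvalid (ltry _).
    by apply: integral_ge0.
  by move=> /eqP; rewrite -EFinB eqe subr_eq0 => /eqP <-.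
- move=> _; split => //; split.
  + move=> hstar; split.
      by apply/starE; exact: (ae_null_dominates QaP).
    apply: filterS hstar => x [_ xmax] Zx.
    have := xmax 0; rewrite /lagrangian Zx !mul0e mule0 !sub0e oppe0 => xmax0.
    apply/eqP; rewrite eq_le mule_ge0 ?lee_fin// andbT.
    rewrite -oppe_ge0; apply: xmax0.
    by apply/half_lineP; exists 0%R.
  + move=> [hsup hcs].
    have epsfin : {ae P, forall x, eps x \is a fin_num}.
      have /(integrable_ae measurableT) : P.-integrable setT eps.
        apply/integrableP; split => //.
        under eq_integral do rewrite gee0_abs//.
        exact: le_lt_trans hvalid (ltry _).
      by apply: filterS => x; exact.
    have hpos := RN_version_ae QaP hZ (starE.2 hsup).
    (* Where Z > 0 optimality is known; where Z = 0 it is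
       lambda * eps = 0, and finiteness of eps puts it in the half line. *)
    apply: filterS3 epsfin hcs hpos => x ex cs pos.
    have := Z0 x; rewrite le_eqVlt => /predU1P[/esym Zx|//].
    split; first by rewrite /half_line /= eps0 ltey_eq ex.
    move=> y /half_lineP[s s0 ->].
    rewrite /lagrangian Zx !mul0e cs// !sub0e oppe0 -EFinM -EFinN lee_fin.
    by rewrite oppr_le0 mulr_ge0.
- move=> hstar U0 slope; apply: filterS (star_sup hstar) => x [_ xsup].
  rewrite lt_neqAle eps0 andbT; apply/eqP => ex0.
  by apply: (superdifferential_neq0 slope); rewrite ex0; exact: xsup.
- move=> hstar U0 dU U'dec U'oo U'0.
  have df (z : R) : (0 < z)%R -> derivable (real_part U) z 1 by move=> /dU[].
  have bij : set_bij [set z : R | (0 < z)%R] [set y : R | (0 < y)%R]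
    (real_deriv U) by exact: derive1_bij.
  split => // Qa0.
  have foc : {ae Qa, forall x, exists2 r : R, (0 < r)%R &
      [/\ (0 < Z x)%R, eps x = r%:E & real_deriv U r = (lambda / Z x)%R]}.
    apply: filterS (star_sup hstar) => x [Zx xsup].
    have [/half_lineP[r r0 er] ex _] := xsup.
    have {}r0 : (0 < r)%R.
      rewrite lt_neqAle r0 andbT; apply/eqP => r00.
      rewrite er -r00 in ex xsup.
      exact: (superdifferential_neq0 (real_deriv_slope0 ex U0 dU U'dec U'oo) xsup).
    exists r => //; split => //; apply: superdifferential_real_deriv => //.
    by rewrite -er.
  have [U'pos U'inj _] := bij; split.
    apply: (ae_cst Qa0); apply: filterS foc => x [r r0 [Zx _ U'r]].
    by have := U'pos r r0; rewrite /= U'r pmulr_lgt0// invr_gt0.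
  apply: filterS foc => x [r r0 [_ -> <-]]; congr (_%:E).
  by rewrite /inverse_deriv pinvKV// inE.
Qed.
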